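(* Let $a_1,b_1,a_2,b_2,a_3,b_3$ be real numbers with $0\le a_i<b_i$ for $i=1,2,3$ and $$a_1b_2b_3+b_1a_2a_3 \;\le\; b_1a_2b_3+a_1b_2a_3 \;\le\; b_1b_2a_3+a_1a_2b_3 .$$ Let $\mathcal{P}_H$ be the trilinear hull and, for $i=1,2,3$, let $\mathcal{P}_i$ be the double-McCormick relaxation obtained by first grouping the two variables other than $x_i$. Then $$\operatorname{Vol}(\mathcal{P}_H)\le\operatorname{Vol}(\mathcal{P}_3)\le\operatorname{Vol}(\mathcal{P}_2)\le\operatorname{Vol}(\mathcal{P}_1).$$
   Context: Points of $\mathbb{R}^4$ are written with coordinates $(f,x_1,x_2,x_3)$; $\operatorname{Vol}$ is 4-dimensional Lebesgue measure. Trilinear hull: $\mathcal{P}_H\subset\mathbb{R}^4$ is the convex hull of the eight points $(x_1x_2x_3,x_1,x_2,x_3)$ with $x_i\in\{a_i,b_i\}$, $i=1,2,3$. Double-McCormick relaxations: for $i\in\{1,2,3\}$ let $\{i,j,k\}=\{1,2,3\}$. Then $\mathcal{P}_i$ is the set of all $(f,x_1,x_2,x_3)\in\mathbb{R}^4$ for which there exists $w\in\mathbb{R}$ satisfying the McCormick inequalities for $w=x_jx_k$, $$w-a_kx_j-a_jx_k+a_ja_k\ge0,\quad -w+b_kx_j+a_jx_k-a_jb_k\ge0,\quad -w+a_kx_j+b_jx_k-b_ja_k\ge0,\quad w-b_kx_j-b_jx_k+b_jb_k\ge0,$$ and the McCormick inequalities for $f=wx_i$ with $w\in[a_ja_k,b_jb_k]$,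 $$f-a_iw-a_ja_kx_i+a_ia_ja_k\ge0,\quad -f+b_iw+a_ja_kx_i-b_ia_ja_k\ge0,\quad -f+a_iw+b_jb_kx_i-a_ib_jb_k\ge0,\quad f-b_iw-b_jb_kx_i+b_ib_jb_k\ge0.$$ (The definition does not depend on the order of $j,k$.) *)

(* Defs.v *)
From HB Require Import structures.
From mathcomp Require Import all_boot all_order all_algebra.
From mathcomp Require Import all_classical all_reals all_analysis.

Set Implicit Arguments.
Unset Strict Implicit.
Unset Printing Implicit Defensive.

Import Order.TTheory GRing.Theory Num.Theory.
Import numFieldNormedType.Exports.

Local Open Scope classical_set_scope.
Local Open Scope ring_scope.

(* A point (f, x1, x2, x3) of R^4 is the left-nested pair (((f, x1), x2), x3). *)
Definition space4 (R : realType) : Type := (R * R * R * R)%type.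

(* The product of Borel-Lebesgue measures agrees with 4-dimensional Lebesgue
   measure on Borel sets, in particular on the compact polytopes below. *)
Definition Vol (R : realType) : set (space4 R) -> \bar R :=
  let mu := @lebesgue_measure R in (((mu \x mu) \x mu) \x mu)%E.

Definition convex_hull (R : realType) (E : lmodType R) (A : set E) : set E :=
  smallest (@convex_set R E) A.

Definition trilinear_vertices (R : realType) (a1 b1 a2 b2 a3 b3 : R) :
    set (space4 R) :=
  [set p | exists x1 x2 x3 : R,
    [/\ [set a1; b1] x1, [set a2; b2] x2, [set a3; b3] x3 &
        p = (x1 * x2 * x3, x1, x2, x3)]].

Definition trilinear_hull (R : realType) (a1 b1 a2 b2 a3 b3 : R) :
    set (space4 R) :=
  @convex_hull R (R * R * R * R)%type (trilinear_vertices a1 b1 a2 b2 a3 b3).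

(* McCormick inequalities for z = x * y with x in [lx, ux] and y in [ly, uy]:
   in order, the expansions of (x - lx)(y - ly) >= 0, (x - lx)(uy - y) >= 0,
   (ux - x)(y - ly) >= 0 and (ux - x)(uy - y) >= 0 with x * y replaced by z. *)
Definition mccormick (R : realType) (lx ux ly uy x y z : R) : Prop :=
  [/\ 0 <= z - ly * x - lx * y + lx * ly,
      0 <= - z + uy * x + lx * y - lx * uy,
      0 <= - z + ly * x + ux * y - ux * ly &
      0 <= z - uy * x - ux * y + ux * uy].

(* The grouping f = (xj * xk) * xi. *)
Definition double_mccormick (R : realType) (ai bi aj bj ak bk f xi xj xk : R) :
    Prop :=
  exists w : R, mccormick aj bj ak bk xj xk w /\
                mccormick (aj * ak) (bj * bk) ai bi w xi f.

Definition P1 (R : realType) (a1 b1 a2 b2 a3 b3 : R) : set (space4 R) :=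
  [set p | let: (f, x1, x2, x3) := p in
           double_mccormick a1 b1 a2 b2 a3 b3 f x1 x2 x3].

Definition P2 (R : realType) (a1 b1 a2 b2 a3 b3 : R) : set (space4 R) :=
  [set p | let: (f, x1, x2, x3) := p in
           double_mccormick a2 b2 a1 b1 a3 b3 f x2 x1 x3].

Definition P3 (R : realType) (a1 b1 a2 b2 a3 b3 : R) : set (space4 R) :=
  [set p | let: (f, x1, x2, x3) := p in
           double_mccormick a3 b3 a1 b1 a2 b2 f x3 x1 x2].

(* Main.v *)
Require Import Defs.
From HB Require Import structures.
From mathcomp Require Import all_boot all_order all_algebra.
From mathcomp Require Import all_classical all_reals all_analysis.
From mathcomp Require Import measurable_realfun ring lra.

Set Implicit Arguments.
Unset Strict Implicit.
Unset Printing Implicit Defensive.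

Import Order.TTheory GRing.Theory Num.Theory.
Import numFieldNormedType.Exports.
Local Open Scope classical_set_scope.
Local Open Scope ring_scope.

(** The fibre of P_i over a point of the box is a segment whose length is a
    piecewise linear function of (x_1, x_2, x_3).  All its kinks are positive
    parts, whose powers have C^1 antiderivatives, so the volume is computed by
    three applications of the fundamental theorem of calculus.  With
    d = b - a and alpha = a / d the result is
      Vol P_i = (d_1 d_2 d_3)^2 ((alpha_1 + alpha_2 + alpha_3 + 2) / 6
                + (4 alpha_j alpha_k - 3) / (24 (1 + alpha_j + alpha_k))),
    so that Vol P_i - Vol P_j has the sign of alpha_j - alpha_i.  The two
    hypotheses factor as (b_3 - a_3) (a_2 b_1 - a_1 b_2) >= 0 and
    (b_1 - a_1) (a_3 b_2 - a_2 b_3) >= 0, i.e. alpha_1 <= alpha_2 <= alpha_3.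
    The trilinear hull is contained in P_3, which is convex and contains the
    eight vertices. *)

(** * Positive parts and antiderivatives of their powers *)

Definition pospart (R : realType) (x : R) : R := Num.max 0 x.

Lemma pospart_ge0 (R : realType) (x : R) : 0 <= pospart x.
Proof. by rewrite /pospart le_max lexx. Qed.

Lemma ge0_pospart (R : realType) (x : R) : 0 <= x -> pospart x = x.
Proof. exact: max_r. Qed.

Lemma le0_pospart (R : realType) (x : R) : x <= 0 -> pospart x = 0.
Proof. exact: max_l. Qed.

Lemma continuous_pospart (R : realType) : continuous (@pospart R).
Proof.
move=> x; apply: (@continuous_max R R (cst 0) id x); first exact: cst_continuous.
exact: cvg_id.
Qed.

Lemma measurable_pospart (R : realType) : measurable_fun setT (@pospart R).
Proof. exact: continuous_measurable_fun (@continuous_pospart R). Qed.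

(** Away from 0 the function agrees locally with 0 or with a monomial. At 0 the difference quotient
    is 0 on the left and [h ^+ n.+1] on the right, which tends to 0 because the exponent [n.+2] is
    at least 2. *)
Lemma is_derive_pospart_exp (R : realType) (n : nat) (x : R) :
  is_derive x 1 (fun t : R => pospart t ^+ n.+2)
    (n.+2%:R * pospart x ^+ n.+1).
Proof.
case: (ltrgtP x 0) => [x0|x0|->].
- rewrite (le0_pospart (ltW x0)) expr0n mulr0.
  apply: (near_eq_is_derive (f := cst 0)).
    near=> t; rewrite le0_pospart ?expr0n//.
    by apply/ltW; near: t; exact: lt_nbhsl.
- rewrite (ge0_pospart (ltW x0)).
  apply: (near_eq_is_derive (f := (fun t : R => t ^+ n.+2))).
    near=> t; rewrite ge0_pospart//.
    by apply/ltW; near: t; exact: lt_nbhsr.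
  have -> : (fun t : R => t ^+ n.+2) = id ^+ n.+2 by rewrite exprfctE.
  apply: is_derive_eq.
  by rewrite /= scaler1.
- rewrite (le0_pospart (lexx 0)) expr0n mulr0.
  have H : (fun h : R => h^-1 *: (pospart (h *: 1 + 0) ^+ n.+2 - pospart 0 ^+ n.+2)) @ 0^' --> (0 : R).
    apply/cvgr0Pnorm_le => e e0.
    near=> h.
    have h0 : h != 0 by near: h; exact: nbhs_dnbhs_neq.
    rewrite (le0_pospart (lexx 0)) expr0n subr0 addr0 /= /GRing.scale/= mulr1 normrM normfV.
    have [hn|hp] := leP h 0.
      by rewrite (le0_pospart hn) expr0n normr0 mulr0 ltW.
    rewrite (ge0_pospart (ltW hp)) normrX exprS mulrA mulVf ?normr_eq0// mul1r.
    have h1 : `|h| <= 1 by near: h; apply: dnbhs0_le.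
    apply: (@le_trans _ _ `|h|).
      by rewrite exprS ler_piMr// exprn_ile1.
    by near: h; apply: dnbhs0_le.
  split.
    by apply/cvg_ex; exists 0.
  by apply/cvg_lim.
Unshelve. all: by end_near.
Qed.

Lemma is_derive_affine (R : realType) (u v x : R) :
  is_derive x 1 (fun t : R => u * t + v) u.
Proof.
have H := is_deriveD (is_deriveZ u (is_derive_id x (1 : R)))
  (is_derive_cst v x (1 : R)).
by apply: (is_derive_eq H); rewrite addr0 /GRing.scale /= mulr1.
Qed.

Lemma is_derive_pospart_affine_exp (R : realType) (n : nat) (c u v x : R) :
  u != 0 ->
  is_derive x 1 (fun t : R => c / (n.+2%:R * u) * pospart (u * t + v) ^+ n.+2)
    (c * pospart (u * x + v) ^+ n.+1).
Proof.
move=> u0.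
have H := @is_derive1_comp _ (fun t => pospart t ^+ n.+2) (fun t => u * t + v) x
  _ _ (is_derive_pospart_exp n (u * x + v)) (is_derive_affine u v x).
apply: (is_derive_eq (is_deriveZ (c / (n.+2%:R * u)) H)).
rewrite /GRing.scale /=; field.
by rewrite -(natrD _ 2) pnatr_eq0 u0.
Qed.

Lemma is_derive_shift_exp (R : realType) (n : nat) (c a x : R) :
  is_derive x 1 (fun t : R => c / n.+1%:R * (t - a) ^+ n.+1)
    (c * (x - a) ^+ n).
Proof.
have H := is_deriveX n.+1 (is_deriveB (is_derive_id x (1 : R))
  (is_derive_cst a x (1 : R))).
rewrite exprfctE in H.
apply: (is_derive_eq (is_deriveZ (c / n.+1%:R) H)).
by rewrite subr0 /GRing.scale /= mulr1 mulrA divfK// pnatr_eq0.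
Qed.

(** * Integration of cubic splines with two kinks over a segment *)

Lemma integral_itv_derive (R : realType) (f F : R -> R) (a b : R) :
  a < b -> continuous f -> (forall x : R, is_derive x 1 F (f x)) ->
  (\int[lebesgue_measure]_(x in `[a, b]) (f x)%:E = (F b - F a)%:E)%E.
Proof.
move=> ab cf dF.
have dFx (x : R) : derivable F x 1 by have [] := dF x.
have cF : continuous F.
  by move=> x; apply/differentiable_continuous/derivable1_diffP.
rewrite (@continuous_FTC2 _ f F)//.
- exact: continuous_subspaceT.
- split.
  + by move=> x _.
  + by apply: cvg_at_right_filter; exact: cF.
  + by apply: cvg_at_left_filter; exact: cF.
- by move=> x _; rewrite derive1E; apply/derive_val.
Qed.

Lemma continuous_shift_exp (R : realType) (n : nat) (c a : R) :
  continuous (fun t : R => c * (t - a) ^+ n).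
Proof.
move=> x; apply: cvgM; first exact: cvg_cst.
apply: (@continuous_comp _ _ _ (fun t : R => t - a) (fun t : R => t ^+ n)).
  by apply: cvgB; [exact: cvg_id|exact: cvg_cst].
exact: exprn_continuous.
Qed.

Lemma continuous_pospart_affine_exp (R : realType) (n : nat) (c u v : R) :
  continuous (fun t : R => c * pospart (u * t + v) ^+ n).
Proof.
move=> x; apply: cvgM; first exact: cvg_cst.
apply: (@continuous_comp _ _ _ (fun t : R => pospart (u * t + v))
  (fun t : R => t ^+ n)); last exact: exprn_continuous.
apply: (@continuous_comp _ _ _ (fun t : R => u * t + v) (@pospart R));
  last exact: continuous_pospart.
apply: differentiable_continuous; apply/derivable1_diffP.
by have [] := is_derive_affine u v x.
Qed.

Lemma integral_spline (R : realType) (a b c0 c1 c2 c3 m1 m2 n1 n2 u v u' v' : R) :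
  a < b -> 0 < u -> 0 < u' -> 0 <= v <= u * (b - a) -> 0 <= v' <= u' * (b - a) ->
  (\int[lebesgue_measure]_(x in `[a, b])
    (c0 + c1 * (x - a) + c2 * (x - a) ^+ 2 + c3 * (x - a) ^+ 3
     + m1 * pospart (u * (x - a) - v) + m2 * pospart (u * (x - a) - v) ^+ 2
     + n1 * pospart (u' * (x - a) - v') + n2 * pospart (u' * (x - a) - v') ^+ 2)%:E
  = (c0 * (b - a) + c1 / 2 * (b - a) ^+ 2 + c2 / 3 * (b - a) ^+ 3
     + c3 / 4 * (b - a) ^+ 4
     + m1 / (2 * u) * (u * (b - a) - v) ^+ 2
     + m2 / (3 * u) * (u * (b - a) - v) ^+ 3
     + n1 / (2 * u') * (u' * (b - a) - v') ^+ 2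
     + n2 / (3 * u') * (u' * (b - a) - v') ^+ 3)%:E)%E.
Proof.
move=> ab u0 u'0 /andP[v0 vu] /andP[v'0 v'u].
pose S (n : nat) c (x : R) := c * (x - a) ^+ n.
pose H (n : nat) c u v (x : R) := c * pospart (u * x + (- u * a - v)) ^+ n.
pose f x := S 0 c0 x + S 1 c1 x + S 2 c2 x + S 3 c3 x
  + H 1 m1 u v x + H 2 m2 u v x + H 1 n1 u' v' x + H 2 n2 u' v' x.
(* The termwise antiderivative: each degree goes up by one. The [c0 / 1] keeps the uniform pattern
   [c / n.+1%:R]. *)
pose F x := S 1 (c0 / 1) x + S 2 (c1 / 2) x + S 3 (c2 / 3) x + S 4 (c3 / 4) x
  + H 2 (m1 / (2 * u)) u v x + H 3 (m2 / (3 * u)) u v x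
  + H 2 (n1 / (2 * u')) u' v' x + H 3 (n2 / (3 * u')) u' v' x.
have affE w z x : w * x + (- w * a - z) = w * (x - a) - z by ring.
transitivity (\int[lebesgue_measure]_(x in `[a, b]) (f x)%:E)%E.
  apply: eq_integral => x _; rewrite /f /S /H !affE; congr EFin.
  by rewrite expr0 !expr1 mulr1.
transitivity (F b - F a)%:E; last first.
  congr EFin.
  have Hb n c w z : 0 <= z <= w * (b - a) -> H n c w z b = c * (w * (b - a) - z) ^+ n.
    by move=> /andP[_ zw]; rewrite /H affE ge0_pospart// subr_ge0.
  have Ha n c w z : 0 <= z <= w * (b - a) -> H n.+1 c w z a = 0.
    move=> /andP[z0 _]; rewrite /H affE subrr mulr0 sub0r le0_pospart ?oppr_le0//.
    by rewrite expr0n mulr0.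
  rewrite /F !Hb ?v0 ?v'0// !Ha ?v0 ?v'0// /S subrr !expr0n /= !mulr0 !addr0 subr0.
  by rewrite divr1 expr1.
have cf : continuous f.
  have cS n c : continuous (S n c) by exact: continuous_shift_exp.
  have cH n c w z : continuous (H n c w z) by exact: continuous_pospart_affine_exp.
  move=> x; rewrite /f; do 4 (apply: cvgD; last exact: cH).
  by do 3 (apply: cvgD; last exact: cS); exact: cS.
have dF (x : R) : is_derive x 1 F (f x).
  have dS n c : is_derive x 1 (S n.+1 (c / n.+1%:R)) (S n c x).
    exact: is_derive_shift_exp.
  have dH n c w z : 0 < w ->
      is_derive x 1 (H n.+2 (c / (n.+2%:R * w)) w z) (H n.+1 c w z x).
    by move=> w0; apply: is_derive_pospart_affine_exp; rewrite gt_eqF.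
  exact: (is_deriveD (is_deriveD (is_deriveD (is_deriveD (is_deriveD (is_deriveD
    (is_deriveD (dS 0%N c0) (dS 1%N c1)) (dS 2%N c2)) (dS 3%N c3))
    (dH 0%N m1 u v u0)) (dH 1%N m2 u v u0)) (dH 0%N n1 u' v' u'0))
    (dH 1%N n2 u' v' u'0)).
exact: (integral_itv_derive ab cf dF).
Qed.

(** * Monotonicity of the volume on arbitrary sets *)

(* No measurability is assumed: the trilinear hull can then be compared with P3
   without proving that it is measurable. *)
Lemma le_integral_ge0 d (T : measurableType d) (R : realType)
    (mu : {measure set T -> \bar R}) (f g : T -> \bar R) :
  (forall x, 0 <= f x)%E -> (forall x, f x <= g x)%E ->
  (\int[mu]_x f x <= \int[mu]_x g x)%E.
Proof.
move=> f0 fg; have g0 x : (0 <= g x)%E by exact: le_trans (fg x).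
rewrite /integral !patch_setT.
have pos h : (forall x, 0 <= h x)%E -> (h ^\+ = h)%E.
  by move=> h0; apply/funext => x; rewrite funeposE; apply: max_l.
have neg h : (forall x, 0 <= h x)%E -> (h ^\- = cst 0)%E.
  by move=> h0; apply/funext => x; rewrite funenegE; apply: max_r; rewrite leeNl oppe0.
rewrite !pos// !neg//; apply: leeB => //.
by apply: le_ereal_sup => _ [h /= hf <-]; exists h => // x; exact: le_trans (fg x).
Qed.

(** The product is the integral over the first factor of [m2] of the sections, so monotonicity of
    the set function [m2] on all sets passes to it. *)
Lemma le_product_measure1 d1 d2 (T1 : measurableType d1)
    (T2 : measurableType d2) (R : realType)
    (m1 : {measure set T1 -> \bar R}) (m2 : set T2 -> \bar R)
    (A B : set (T1 * T2)) :
  (forall C, 0 <= m2 C)%E -> (forall C D, C `<=` D -> m2 C <= m2 D)%E ->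
  A `<=` B -> ((m1 \x m2) A <= (m1 \x m2) B)%E.
Proof.
move=> m20 m2le AB; apply: le_integral_ge0 => x; first exact: m20.
by apply: m2le => y; rewrite /xsection /= !inE; exact: AB.
Qed.

(** Lebesgue measure is built as an outer measure, which is monotone on all sets. *)
Lemma le_lebesgue_measure (R : realType) (A B : set R) :
  A `<=` B -> (lebesgue_measure A <= lebesgue_measure B)%E.
Proof.
by move=> AB; rewrite /lebesgue_measure /lebesgue_stieltjes_measure; apply: le_mu_ext.
Qed.

Lemma le_Vol (R : realType) (A B : set (space4 R)) :
  A `<=` B -> (Vol A <= Vol B)%E.
Proof.
move=> AB; rewrite /Vol; set mu := @lebesgue_measure R.
apply: (@le_product_measure1 _ _ _ _ R (((mu \x mu) \x mu)%E) mu) => //.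
exact: le_lebesgue_measure.
Qed.

(** * The volume as an iterated integral, in three orders *)

(** The product measure is defined through sections at the first coordinate. Tonelli for the
    indicator of [A] gives sections at the second one, which suits left-nested tuples, where the
    last coordinate is peeled off first. *)
Lemma product_measure1_ysection d1 d2 (T1 : measurableType d1)
    (T2 : measurableType d2) (R : realType)
    (m1 : {sigma_finite_measure set T1 -> \bar R})
    (m2 : {sigma_finite_measure set T2 -> \bar R}) (A : set (T1 * T2)) :
  measurable A -> ((m1 \x m2) A = \int[m2]_y m1 (ysection A y))%E.
Proof.
move=> mA; rewrite /product_measure1.
have := @indic_fubini_tonelli _ _ _ _ _ m1 m2 A mA.
by rewrite indic_fubini_tonelli_FE// indic_fubini_tonelli_GE.
Qed.

(** Rectangles built from two nondecreasing exhaustions of finite measure exhaust the product: a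
    point is caught at the larger of its two indices. *)
Lemma sigma_finite_product_measure1 d1 d2 (T1 : measurableType d1)
    (T2 : measurableType d2) (R : realType)
    (m1 : {sigma_finite_measure set T1 -> \bar R})
    (m2 : {sigma_finite_measure set T2 -> \bar R}) :
  sigma_finite setT (m1 \x m2)%E.
Proof.
have /sigma_finiteP[F [TF ndF Foo]] := sigma_finiteT m1.
have /sigma_finiteP[G [TG ndG Goo]] := sigma_finiteT m2.
exists (fun n => F n `*` G n).
  apply/esym/seteqP; split => // -[x y] _.
  have [n _ Fnx] : (\bigcup_i F i) x by rewrite -TF.
  have [k _ Gky] : (\bigcup_i G i) y by rewrite -TG.
  exists (maxn n k) => //; split.
    by move: x Fnx; exact/subsetPset/ndF/leq_maxl.
  by move: y Gky; exact/subsetPset/ndG/leq_maxr.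
move=> k; have [mF Fk] := Foo k; have [mG Gk] := Goo k.
split; first exact: measurableX.
by rewrite product_measure1E// lte_mul_pinfty// ge0_fin_numE.
Qed.

(* The canonical sigma-finite structure of [m1 \x m2] in the library is shadowed
   by the one for probability measures, hence this explicit packaging. *)
Definition product_sigma_finite d1 d2 (T1 : measurableType d1)
    (T2 : measurableType d2) (R : realType)
    (m1 : {sigma_finite_measure set T1 -> \bar R})
    (m2 : {sigma_finite_measure set T2 -> \bar R}) :
    {sigma_finite_measure set (T1 * T2)%type -> \bar R} :=
  HB.pack (m1 \x m2)%E
    (Measure_isSigmaFinite.Build _ _ _ (m1 \x m2)%E
      (sigma_finite_product_measure1 m1 m2)).

Section Vol_iterated.
Variable R : realType.
Local Notation mu := (@lebesgue_measure R).
Local Notation T := (measurableTypeR R).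
Variable A : set (T * T * T * T).
Hypothesis mA : measurable A.
Let slice (x : T * T * T) := mu [set f | A (f, x.1.1, x.1.2, x.2)].

Let measurable_slice : measurable_fun setT slice.
Proof.
(* [B] is [A] reassociated with [f] split off, so that [slice] measures its sections at the second
   coordinate. *)
pose B : set (T * (T * T * T)) :=
  (fun q => (q.1, q.2.1.1, q.2.1.2, q.2.2)) @^-1` A.
have mB : measurable B.
  rewrite -[B]setTI; apply: (_ : measurable_fun setT _) => //.
  do ! apply: measurable_fun_pair => //; do ! apply: measurableT_comp => //.
have := measurable_fun_ysection mu mB.
congr (measurable_fun _ _); apply/funext => -[[x1 x2] x3] /=; congr mu.
by apply/seteqP; split => f; rewrite /ysection /= inE.
Qed.

Let slice_ge0 x : (0 <= slice x)%E. Proof. exact: measure_ge0. Qed.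

Let measurable_slice3 (z : T) : measurable_fun setT (fun xy : T * T => slice (xy, z)).
Proof. exact: measurableT_comp. Qed.

(** In this lemma and the next two the digits list the variables from the inside out. The three
    orders put x_i innermost for P_1, P_2 and P_3 respectively. *)
Lemma Vol_integral123 :
  (@Vol R A = \int[mu]_z \int[mu]_y \int[mu]_x mu [set f | A (f, x, y, z)])%E.
Proof.
pose mu2 := product_sigma_finite mu mu; pose mu3 := product_sigma_finite mu2 mu.
(* Each such [transitivity] is a conversion that exposes the sigma-finite structure of the left
   factor. *)
transitivity ((mu3 \x mu) A)%E; first by [].
rewrite (product_measure1_ysection _ _ mA); apply: eq_integral => z _.
have mz : measurable (ysection A z) by exact: measurable_ysection.
transitivity ((mu2 \x mu) (ysection A z))%E; first by [].
rewrite (product_measure1_ysection _ _ mz); apply: eq_integral => y _.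
have my : measurable (ysection (ysection A z) y) by exact: measurable_ysection.
transitivity ((mu \x mu) (ysection (ysection A z) y))%E; first by [].
rewrite (product_measure1_ysection _ _ my); apply: eq_integral => x _.
congr mu; apply/seteqP; split => f; first by move=> /ysectionP/ysectionP/ysectionP.
by move=> Af; do 3 apply/ysectionP.
Qed.

Lemma Vol_integral213 :
  (@Vol R A = \int[mu]_z \int[mu]_x \int[mu]_y mu [set f | A (f, x, y, z)])%E.
Proof.
rewrite Vol_integral123; apply: eq_integral => z _.
exact: esym (@fubini_tonelli _ _ T T R mu mu (fun xy => slice (xy, z))
  (measurable_slice3 z) (fun xy => slice_ge0 (xy, z))).
Qed.

(** Two exchanges by Tonelli: first [z] with [y] around the inner integral [h], then [z] with [x]
    for fixed [y]. *)
Lemma Vol_integral312 :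
  (@Vol R A = \int[mu]_y \int[mu]_x \int[mu]_z mu [set f | A (f, x, y, z)])%E.
Proof.
rewrite Vol_integral123.
pose h (q : T * T) := (\int[mu]_x slice (x, q.1, q.2))%E.
have mh : measurable_fun setT h.
  have := @measurable_fun_fubini_tonelli_G _ _ T (T * T)%type R mu
    (fun p => slice (p.1, p.2.1, p.2.2)).
  apply; last by move=> p; exact: slice_ge0.
  apply: (measurableT_comp measurable_slice).
  have m21 := measurableT_comp (@measurable_fst _ _ T T) (@measurable_snd _ _ T (T * T)%type).
  have m22 := measurableT_comp (@measurable_snd _ _ T T) (@measurable_snd _ _ T (T * T)%type).
  exact: measurable_fun_pair (measurable_fun_pair measurable_fst m21) m22.
have h0 q : (0 <= h q)%E by exact: integral_ge0.
apply: etrans (esym (@fubini_tonelli _ _ T T R mu mu h mh h0)) _.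
apply: eq_integral => y _.
have my : measurable_fun setT (fun p : T * T => slice (p.1, y, p.2)).
  apply: (measurableT_comp measurable_slice).
  apply: measurable_fun_pair measurable_snd.
  exact: measurable_fun_pair measurable_fst (measurable_cst y).
exact: esym (fubini_tonelli _ my (fun p => slice_ge0 (p.1, y, p.2))).
Qed.

End Vol_iterated.

(** * McCormick envelopes written with positive parts *)

Lemma pospart_opp (R : realType) (x : R) : pospart (- x) = pospart x - x.
Proof.
have [x0|x0] := leP 0 x.
  by rewrite le0_pospart ?oppr_le0// ge0_pospart// subrr.
by rewrite ge0_pospart ?oppr_ge0 ?ltW// le0_pospart ?ltW// sub0r.
Qed.

Lemma mulr_pospart (R : realType) (x : R) : x * pospart x = pospart x ^+ 2.
Proof.
have [x0|x0] := leP 0 x; first by rewrite ge0_pospart.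
by rewrite le0_pospart ?ltW// mulr0 expr0n.
Qed.

Lemma pospart_le (R : realType) (x y : R) : (pospart x <= y) = (0 <= y) && (x <= y).
Proof. exact: ge_max. Qed.

Lemma addr_pospart_le (R : realType) (a x z : R) :
  (a + pospart x <= z) = (a <= z) && (a + x <= z).
Proof. by rewrite addrC -lerBrDr pospart_le subr_ge0 lerBrDr [x + a]addrC. Qed.

Lemma le_subr_pospart (R : realType) (a x z : R) :
  (z <= a - pospart x) = (z <= a) && (z <= a - x).
Proof. by rewrite lerBrDr -lerBrDl pospart_le subr_ge0 lerBrDl -lerBrDr. Qed.

(** The maximum of the two McCormick lower bounds, written as the first one plus the positive part
    of the difference. [mc_upper] is likewise the minimum of the two upper bounds. *)
Definition mc_lower (R : realType) (lx ux ly uy x y : R) : R :=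
  ly * x + lx * y - lx * ly + pospart ((uy - ly) * (x - lx) - (ux - lx) * (uy - y)).

Definition mc_upper (R : realType) (lx ux ly uy x y : R) : R :=
  uy * x + lx * y - lx * uy - pospart ((uy - ly) * (x - lx) - (ux - lx) * (y - ly)).

(** Adding two of the inequalities so that [z] cancels gives the box: the first and second sum to
    [(uy - ly) * (x - lx) >= 0], and similarly for the other three sides. What remains is two lower
    and two upper bounds on [z]. *)
Lemma mccormickP (R : realType) (lx ux ly uy x y z : R) : lx < ux -> ly < uy ->
  mccormick lx ux ly uy x y z <->
  [/\ lx <= x <= ux, ly <= y <= uy &
      mc_lower lx ux ly uy x y <= z <= mc_upper lx ux ly uy x y].
Proof.
move=> lux luy; rewrite /mc_lower /mc_upper addr_pospart_le le_subr_pospart.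
split=> [[h1 h2 h3 h4]|[_ _ /andP[/andP[h1 h2] /andP[h3 h4]]]]; last by split; lra.
have dy0 : 0 < uy - ly by rewrite subr_gt0.
have dx0 : 0 < ux - lx by rewrite subr_gt0.
split; last 1 first.
- by apply/andP; split; apply/andP; split; lra.
- rewrite -subr_ge0 -[X in _ && X]subr_ge0 -(pmulr_rge0 _ dy0).
  by rewrite -[X in _ && X](pmulr_rge0 _ dy0); apply/andP; split; lra.
- rewrite -subr_ge0 -[X in _ && X]subr_ge0 -(pmulr_rge0 _ dx0).
  by rewrite -[X in _ && X](pmulr_rge0 _ dx0); apply/andP; split; lra.
Qed.

Lemma mccormick_mul (R : realType) (lx ux ly uy x y : R) :
  lx <= x <= ux -> ly <= y <= uy -> mccormick lx ux ly uy x y (x * y).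
Proof.
move=> /andP[x1 x2] /andP[y1 y2].
have e1 : 0 <= (x - lx) * (y - ly) by rewrite mulr_ge0 ?subr_ge0.
have e2 : 0 <= (x - lx) * (uy - y) by rewrite mulr_ge0 ?subr_ge0.
have e3 : 0 <= (ux - x) * (y - ly) by rewrite mulr_ge0 ?subr_ge0.
have e4 : 0 <= (ux - x) * (uy - y) by rewrite mulr_ge0 ?subr_ge0.
by split; lra.
Qed.

Lemma mccormick_conv (R : realType) (lx ux ly uy x y z x' y' z' t : R) :
  0 <= t <= 1 -> mccormick lx ux ly uy x y z -> mccormick lx ux ly uy x' y' z' ->
  mccormick lx ux ly uy (t * x + (1 - t) * x') (t * y + (1 - t) * y')
    (t * z + (1 - t) * z').
Proof.
move=> /andP[t0]; rewrite -subr_ge0 => t1 [h1 h2 h3 h4] [k1 k2 k3 k4].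
have c (A B : R) : 0 <= A -> 0 <= B -> 0 <= t * A + (1 - t) * B.
  by move=> A0 B0; rewrite addr_ge0// mulr_ge0.
move: (c _ _ h1 k1) (c _ _ h2 k2) (c _ _ h3 k3) (c _ _ h4 k4) => c1 c2 c3 c4.
by split; lra.
Qed.

(** * Convexity and fibres of the double-McCormick relaxation *)

Lemma double_mccormick_conv (R : realType)
    (ai bi aj bj ak bk f xi xj xk f' xi' xj' xk' t : R) :
  0 <= t <= 1 -> double_mccormick ai bi aj bj ak bk f xi xj xk ->
  double_mccormick ai bi aj bj ak bk f' xi' xj' xk' ->
  double_mccormick ai bi aj bj ak bk (t * f + (1 - t) * f')
    (t * xi + (1 - t) * xi') (t * xj + (1 - t) * xj') (t * xk + (1 - t) * xk').
Proof.
move=> t01 [w [w1 w2]] [w' [w'1 w'2]]; exists (t * w + (1 - t) * w').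
by split; exact: mccormick_conv.
Qed.

(** Lower end of the fibre in [f]: for [0 <= ai < bi] the outer envelopes are nondecreasing in [w],
    so the least [w] yields the least [f]. [dm_upper] is the upper end, reached at the greatest
    [w]. *)
Definition dm_lower (R : realType) (ai bi aj bj ak bk xi xj xk : R) : R :=
  mc_lower (aj * ak) (bj * bk) ai bi (mc_lower aj bj ak bk xj xk) xi.

Definition dm_upper (R : realType) (ai bi aj bj ak bk xi xj xk : R) : R :=
  mc_upper (aj * ak) (bj * bk) ai bi (mc_upper aj bj ak bk xj xk) xi.

Section double_mccormick.
Variables (R : realType) (ai bi aj bj ak bk : R).
Hypotheses (hi : 0 <= ai < bi) (hj : 0 <= aj < bj) (hk : 0 <= ak < bk).

Lemma mulr_lt_bounds : aj * ak < bj * bk.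
Proof.
move: hj hk => /andP[aj0 ajbj] /andP[ak0 akbk].
exact: ltr_pM.
Qed.

(** The outer inequalities take [w] in [[aj * ak, bj * bk]]. The outer two bounds rest on
    nonnegativity, e.g. [ak * (xj - aj) + aj * (xk - ak) >= 0]; the middle one holds because
    [xj * xk] lies between the envelopes. *)
Lemma mc_bounds (xj xk : R) : aj <= xj <= bj -> ak <= xk <= bk ->
  [/\ aj * ak <= mc_lower aj bj ak bk xj xk,
      mc_lower aj bj ak bk xj xk <= mc_upper aj bj ak bk xj xk &
      mc_upper aj bj ak bk xj xk <= bj * bk].
Proof.
move: hj hk => /andP[aj0 ajbj] /andP[ak0 akbk] xjb xkb; split.
- move: xjb xkb => /andP[j1 j2] /andP[k1 k2]; rewrite /mc_lower.
  have := pospart_ge0 ((bk - ak) * (xj - aj) - (bj - aj) * (bk - xk)).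
  have : 0 <= ak * (xj - aj) by rewrite mulr_ge0 ?subr_ge0.
  have : 0 <= aj * (xk - ak) by rewrite mulr_ge0 ?subr_ge0.
  by lra.
- have /(mccormickP _ _ _ ajbj akbk)[_ _ /andP[]] := mccormick_mul xjb xkb.
  exact: le_trans.
- move: xjb xkb => /andP[j1 j2] /andP[k1 k2]; rewrite /mc_upper.
  have := pospart_ge0 ((bk - ak) * (xj - aj) - (bj - aj) * (xk - ak)).
  have bk0 : 0 <= bk by rewrite (le_trans ak0)// ltW.
  have : 0 <= bk * (bj - xj) by rewrite mulr_ge0 ?subr_ge0.
  have : 0 <= aj * (bk - xk) by rewrite mulr_ge0 ?subr_ge0.
  by lra.
Qed.

Lemma mc_lower_homo (xi w w' : R) : w <= w' ->
  mc_lower (aj * ak) (bj * bk) ai bi w xi <= mc_lower (aj * ak) (bj * bk) ai bi w' xi.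
Proof.
move: hi => /andP[ai0 aibi] ww'; rewrite /mc_lower lerD//.
  by rewrite lerB// lerD// ler_wpM2l.
rewrite pospart_le pospart_ge0/=.
apply: (@le_trans _ _ ((bi - ai) * (w' - aj * ak) - (bj * bk - aj * ak) * (bi - xi))).
  by rewrite lerB// ler_wpM2l ?lerB// subr_ge0 ltW.
(* Reflexivity, read through [pospart_le], says that a number is at most its positive part. *)
by have := lexx (pospart ((bi - ai) * (w' - aj * ak) - (bj * bk - aj * ak) * (bi - xi)));
  rewrite {1}pospart_le => /andP[].
Qed.

(** The linear term grows by [bi * (w' - w)] and the positive part by at most
    [(bi - ai) * (w' - w)], which leaves at least [ai * (w' - w) >= 0]. *)
Lemma mc_upper_homo (xi w w' : R) : w <= w' ->
  mc_upper (aj * ak) (bj * bk) ai bi w xi <= mc_upper (aj * ak) (bj * bk) ai bi w' xi.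
Proof.
move: hi => /andP[ai0 aibi] ww'; rewrite /mc_upper.
set c := (_ - _) * (xi - _).
set p := pospart ((bi - ai) * (w - aj * ak) - c).
set p' := pospart ((bi - ai) * (w' - aj * ak) - c).
have p0 : 0 <= p by exact: pospart_ge0.
have pp : (bi - ai) * (w - aj * ak) - c <= p.
  by have := lexx p; rewrite {1}/p pospart_le => /andP[].
have aw : 0 <= ai * (w' - w) by rewrite mulr_ge0// subr_ge0.
have dw : 0 <= (bi - ai) * (w' - w) by rewrite mulr_ge0// subr_ge0// ltW.
have : p' <= p + (bi - ai) * (w' - w).
  by rewrite pospart_le; apply/andP; split; lra.
by lra.
Qed.

(* For fixed [xi, xj, xk] the admissible pairs [(w, f)] form a convex set
   containing [(w_min, f_min)] and [(w_max, f_max)], so that every intermediate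
   [f] is reached on the segment joining these two pairs. *)
Lemma double_mccormickP (f xi xj xk : R) :
  double_mccormick ai bi aj bj ak bk f xi xj xk <->
  [/\ ai <= xi <= bi, aj <= xj <= bj, ak <= xk <= bk &
      dm_lower ai bi aj bj ak bk xi xj xk <= f <= dm_upper ai bi aj bj ak bk xi xj xk].
Proof.
have aibi : ai < bi by case/andP: hi.
have ajbj : aj < bj by case/andP: hj.
have akbk : ak < bk by case/andP: hk.
have Lw := mulr_lt_bounds.
split=> [[w [/(mccormickP _ _ _ ajbj akbk)[xjb xkb /andP[w1 w2]]]]|].
  move=> /(mccormickP _ _ _ Lw aibi)[_ xib /andP[f1 f2]]; split=> //.
  rewrite (le_trans _ f1) ?(le_trans f2)//; first exact: mc_upper_homo.
  exact: mc_lower_homo.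
move=> [xib xjb xkb /andP[f1 f2]].
have [L1 L2 L3] := mc_bounds xjb xkb.
set l := mc_lower aj bj ak bk xj xk in L1 L2.
set u := mc_upper aj bj ak bk xj xk in L2 L3.
have le_lu w : aj * ak <= w <= bj * bk ->
    mc_lower (aj * ak) (bj * bk) ai bi w xi <= mc_upper (aj * ak) (bj * bk) ai bi w xi.
  move=> wb; have /(mccormickP _ _ _ Lw aibi)[_ _ /andP[]] := mccormick_mul wb xib.
  exact: le_trans.
have lb : aj * ak <= l <= bj * bk by rewrite L1 (le_trans L2).
have ub : aj * ak <= u <= bj * bk by rewrite L3 (le_trans L1).
have low : double_mccormick ai bi aj bj ak bk (dm_lower ai bi aj bj ak bk xi xj xk) xi xj xk.
  exists l; split; first by apply/mccormickP => //; split=> //; rewrite lexx.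
  by apply/mccormickP => //; split=> //; rewrite lexx le_lu.
have upp : double_mccormick ai bi aj bj ak bk (dm_upper ai bi aj bj ak bk xi xj xk) xi xj xk.
  exists u; split; first by apply/mccormickP => //; split=> //; rewrite lexx andbT.
  by apply/mccormickP => //; split=> //; rewrite lexx andbT le_lu.
move: low upp f1 f2; set f1 := dm_lower _ _ _ _ _ _ _ _ _; set f2 := dm_upper _ _ _ _ _ _ _ _ _.
move=> low upp f1f ff2.
have [f12|f12] := leP f2 f1.
  by have -> : f = f1 by apply/eqP; rewrite eq_le f1f (le_trans ff2).
have d0 : 0 < f2 - f1 by rewrite subr_gt0.
(* The weight for which [t * f1 + (1 - t) * f2 = f]. *)
pose t := (f2 - f) / (f2 - f1).
have t01 : 0 <= t <= 1.
  rewrite /t divr_ge0 ?subr_ge0 ?(ltW f12)//= ler_pdivrMr// mul1r; lra.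
have := double_mccormick_conv t01 low upp.
congr double_mccormick; rewrite /t; field; rewrite gt_eqF//.
Qed.

(** Raise [w] to the upper inner envelope in the outer lower bound; at that [w] the product [w * xi]
    separates the two outer bounds. *)
Lemma dm_lower_le_upper (xi xj xk : R) :
  ai <= xi <= bi -> aj <= xj <= bj -> ak <= xk <= bk ->
  dm_lower ai bi aj bj ak bk xi xj xk <= dm_upper ai bi aj bj ak bk xi xj xk.
Proof.
move=> xib xjb xkb.
have [L1 L2 L3] := mc_bounds xjb xkb.
have aibi : ai < bi by case/andP: hi.
apply: le_trans (mc_lower_homo xi L2) _.
have ub : aj * ak <= mc_upper aj bj ak bk xj xk <= bj * bk.
  by rewrite L3 (le_trans L1).
have /(mccormickP _ _ _ mulr_lt_bounds aibi)[_ _ /andP[]] := mccormick_mul ub xib.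
exact: le_trans.
Qed.

End double_mccormick.

(** * Measurability of the relaxations *)

Section measurable_double_mccormick.
Context d (X : measurableType d) (R : realType).

Lemma measurable_mc_lower (lx ux ly uy : R) (F G : X -> R) :
  measurable_fun setT F -> measurable_fun setT G ->
  measurable_fun setT (fun x => mc_lower lx ux ly uy (F x) (G x)).
Proof.
move=> mF mG; apply: measurable_funD.
  by apply: measurable_funB => //; apply: measurable_funD => //;
    exact: measurable_funM.
apply: (measurableT_comp (@measurable_pospart R)).
apply: measurable_funB; apply: measurable_funM => //; exact: measurable_funB.
Qed.

Lemma measurable_mc_upper (lx ux ly uy : R) (F G : X -> R) :
  measurable_fun setT F -> measurable_fun setT G ->
  measurable_fun setT (fun x => mc_upper lx ux ly uy (F x) (G x)).
Proof.
move=> mF mG; apply: measurable_funB.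
  by apply: measurable_funB => //; apply: measurable_funD => //;
    exact: measurable_funM.
apply: (measurableT_comp (@measurable_pospart R)).
apply: measurable_funB; apply: measurable_funM => //; exact: measurable_funB.
Qed.

(** [double_mccormickP] eliminates the existential over [w]; a finite conjunction of inequalities
    between measurable functions remains. *)
Lemma measurable_double_mccormick (ai bi aj bj ak bk : R) (F XI XJ XK : X -> R) :
  0 <= ai < bi -> 0 <= aj < bj -> 0 <= ak < bk ->
  measurable_fun setT F -> measurable_fun setT XI ->
  measurable_fun setT XJ -> measurable_fun setT XK ->
  measurable [set x | double_mccormick ai bi aj bj ak bk (F x) (XI x) (XJ x) (XK x)].
Proof.
move=> hi hj hk mF mI mJ mK.
pose l x := dm_lower ai bi aj bj ak bk (XI x) (XJ x) (XK x).
pose u x := dm_upper ai bi aj bj ak bk (XI x) (XJ x) (XK x).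
have ml : measurable_fun setT l by apply: measurable_mc_lower => //; exact: measurable_mc_lower.
have mu : measurable_fun setT u by apply: measurable_mc_upper => //; exact: measurable_mc_upper.
pose b x := [&& ai <= XI x <= bi, aj <= XJ x <= bj, ak <= XK x <= bk & l x <= F x <= u x].
have mb : measurable_fun setT b.
  by do ! apply: measurable_and; apply: measurable_fun_ler.
rewrite [X in measurable X](_ : _ = setT `&` b @^-1` [set true]); first exact: mb.
rewrite setTI; apply/seteqP; split => x /=.
  by move=> /(double_mccormickP hi hj hk)[i j k f]; apply/and4P.
by move=> /and4P[i j k f]; apply/(double_mccormickP hi hj hk).
Qed.

End measurable_double_mccormick.

(** * Inclusion of the trilinear hull in P_3 *)

Lemma trilinear_hull_P3 (R : realType) (a1 b1 a2 b2 a3 b3 : R) :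
  0 <= a1 < b1 -> 0 <= a2 < b2 -> a3 < b3 ->
  trilinear_hull a1 b1 a2 b2 a3 b3 `<=` P3 a1 b1 a2 b2 a3 b3.
Proof.
move=> /andP[a10 h1] /andP[a20 h2] h3; apply: smallest_sub.
  move=> [[[f x1] x2] x3] [[[f' x1'] x2'] x3'] t /set_mem p /set_mem p'.
  apply/mem_set; rewrite /P3 /=.
  have t01 : 0 <= t%:num <= 1 by rewrite ge0 le1.
  exact: double_mccormick_conv t01 p p'.
move=> _ [x1 [x2 [x3 [e1 e2 e3 ->]]]] /=.
have itv (a b x : R) : a < b -> [set a; b] x -> a <= x <= b.
  by move=> ab [->|->]; rewrite lexx ltW.
have x1b := itv _ _ _ h1 e1; have x2b := itv _ _ _ h2 e2.
have x3b := itv _ _ _ h3 e3.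
(* At a vertex the true product satisfies both families of McCormick inequalities. *)
exists (x1 * x2); split; apply: mccormick_mul => //.
move: x1b x2b => /andP[l1 u1] /andP[l2 u2].
have x10 := le_trans a10 l1; have x20 := le_trans a20 l2.
by rewrite !ler_pM.
Qed.

(** * The closed volume formula and its comparison under exchange of variables *)

(** The formula announced at the start with the alphas cleared: [p / r] is alpha_k, [q / r] is
    alpha_j, and [bj * bk - aj * ak] equals [p + q + r]. *)
Definition double_mccormick_vol (R : realType) (ai bi aj bj ak bk : R) : R :=
  let di := bi - ai in let dj := bj - aj in let dk := bk - ak in
  let p := ak * dj in let q := aj * dk in let r := dj * dk in
  di * dj * dk * (ai * r / 6 + di *
    ((p ^+ 2 + q ^+ 2) / 3 + p * q + r * (p + q) + 5 / 12 * r ^+ 2)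
    / (2 * (bj * bk - aj * ak))).

Lemma double_mccormick_vol_sym (R : realType) (ai bi aj bj ak bk : R) :
  double_mccormick_vol ai bi aj bj ak bk = double_mccormick_vol ai bi ak bk aj bj.
Proof.
rewrite /double_mccormick_vol [bk * bj]mulrC [ak * aj]mulrC.
by congr (_ * (_ + _ * _ / _)); ring.
Qed.

(** The difference of the two volumes factors explicitly, and [bi * aj - ai * bj] is the only factor
    whose sign comes from the last hypothesis. *)
Lemma le_double_mccormick_vol (R : realType) (ai bi aj bj ak bk : R) :
  0 <= ai < bi -> 0 <= aj < bj -> 0 <= ak < bk -> ai * bj <= bi * aj ->
  double_mccormick_vol aj bj ai bi ak bk <= double_mccormick_vol ai bi aj bj ak bk.
Proof.
move=> hi hj hk ij.
have Di := mulr_lt_bounds hi hk; have Dj := mulr_lt_bounds hj hk.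
rewrite -subr_ge0.
have -> : double_mccormick_vol ai bi aj bj ak bk - double_mccormick_vol aj bj ai bi ak bk
  = ((bi - ai) * (bj - aj) * (bk - ak)) ^+ 2 * (bi * aj - ai * bj)
    * (4 * ak ^+ 2 + 4 * ak * (bk - ak) + 3 * (bk - ak) ^+ 2)
    / (24 * (bj * bk - aj * ak) * (bi * bk - ai * ak)).
  by rewrite /double_mccormick_vol; field; rewrite !subr_eq0 !gt_eqF.
case/andP: hk => ak0 akbk.
have dk0 : 0 <= bk - ak by rewrite subr_ge0 ltW.
apply: divr_ge0; last by rewrite !mulr_ge0 ?subr_ge0 ?(ltW Di) ?(ltW Dj).
apply: mulr_ge0; first by apply: mulr_ge0; rewrite ?sqr_ge0 ?subr_ge0.
by rewrite !addr_ge0 ?mulr_ge0 ?exprn_ge0.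
Qed.

(** * Three successive integrations of the fibre length *)

Lemma integral_if_itv (R : realType) (a b : R) (F : R -> \bar R) :
  (\int[@lebesgue_measure R]_x (if (a <= x <= b)%R then F x else 0)
   = \int[@lebesgue_measure R]_(x in `[a, b]) F x)%E.
Proof.
rewrite [RHS]integral_mkcond; apply: eq_integral => x _.
by rewrite patchE mem_setE in_itv.
Qed.

(** Puts the fibre length in the form of [integral_spline]: both positive parts get the slope
    [ux - lx] in [y], one of them after a change of sign by [pospart_opp]. *)
Lemma mc_gapE (R : realType) (lx ux ly uy l u y : R) :
  mc_upper lx ux ly uy u y - mc_lower lx ux ly uy l y =
  ly * (u - l) + (ux - lx) * (y - ly)
  - pospart ((ux - lx) * (y - ly) - (uy - ly) * (u - lx))
  - pospart ((ux - lx) * (y - ly) - (uy - ly) * (ux - l)).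
Proof.
rewrite /mc_upper /mc_lower.
have -> : (uy - ly) * (l - lx) - (ux - lx) * (uy - y) =
  (ux - lx) * (y - ly) - (uy - ly) * (ux - l) by ring.
have -> : (uy - ly) * (u - lx) - (ux - lx) * (y - ly) =
  - ((ux - lx) * (y - ly) - (uy - ly) * (u - lx)) by ring.
by rewrite pospart_opp; ring.
Qed.

Section double_mccormick_integral.
Variables (R : realType) (ai bi aj bj ak bk : R).
Hypotheses (hi : 0 <= ai < bi) (hj : 0 <= aj < bj) (hk : 0 <= ak < bk).
Local Notation mu := (@lebesgue_measure R).
Local Notation L := (aj * ak).
Local Notation U := (bj * bk).
Local Notation wl := (mc_lower aj bj ak bk).
Local Notation wu := (mc_upper aj bj ak bk).

(** The value of the integral over [xi]. The last two squares come from the two kinks of the fibre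
    length. *)
Let fibre_integral (xj xk : R) : R :=
  ai * (bi - ai) * (wu xj xk - wl xj xk)
  + (bi - ai) ^+ 2 / (2 * (U - L)) *
    ((U - L) ^+ 2 - (U - wu xj xk) ^+ 2 - (wl xj xk - L) ^+ 2).

(** The box conditions are nested with that on [xi] innermost, so that each integration removes one
    of them. *)
Lemma measure_double_mccormick (xi xj xk : R) :
  mu [set f | double_mccormick ai bi aj bj ak bk f xi xj xk] =
  (if (ak <= xk <= bk)%R then if (aj <= xj <= bj)%R then if (ai <= xi <= bi)%R then
    (dm_upper ai bi aj bj ak bk xi xj xk - dm_lower ai bi aj bj ak bk xi xj xk)%R%:E
    else 0 else 0 else 0)%E.
Proof.
case: ifPn => [xkb|/negP xkb]; last first.
  rewrite (_ : [set f | _] = set0) ?measure0// -subset0 => f /=.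
  by move=> /(double_mccormickP hi hj hk)[].
case: ifPn => [xjb|/negP xjb]; last first.
  rewrite (_ : [set f | _] = set0) ?measure0// -subset0 => f /=.
  by move=> /(double_mccormickP hi hj hk)[].
case: ifPn => [xib|/negP xib]; last first.
  rewrite (_ : [set f | _] = set0) ?measure0// -subset0 => f /=.
  by move=> /(double_mccormickP hi hj hk)[].
have := dm_lower_le_upper hi hj hk xib xjb xkb.
set l := dm_lower _ _ _ _ _ _ _ _ _; set u := dm_upper _ _ _ _ _ _ _ _ _ => lu.
rewrite (_ : [set f | _] = `[l, u]%classic); last first.
  apply/seteqP; split => f /=; rewrite in_itv/=.
    by move=> /(double_mccormickP hi hj hk)[].
  by move=> lfu; apply/(double_mccormickP hi hj hk).
rewrite lebesgue_measure_itv/= lte_fin; case: ltP => // ul.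
have -> : u = l by apply/eqP; rewrite eq_le ul.
by rewrite subrr.
Qed.

Lemma integral1_double_mccormick (xj xk : R) :
  (\int[mu]_xi mu [set f | double_mccormick ai bi aj bj ak bk f xi xj xk] =
  (if (ak <= xk <= bk)%R then if (aj <= xj <= bj)%R then (fibre_integral xj xk)%:E else 0 else 0))%E.
Proof.
under eq_integral do rewrite measure_double_mccormick.
case: ifPn => xkb; last exact: integral0.
case: ifPn => xjb; last exact: integral0.
have [L1 L2 L3] := mc_bounds hj hk xjb xkb.
have LU := mulr_lt_bounds hj hk.
have aibi : ai < bi by case/andP: hi.
have di0 : 0 < bi - ai by rewrite subr_gt0.
rewrite integral_if_itv.
pose di := bi - ai.
under eq_integral => x _.
  have -> : dm_upper ai bi aj bj ak bk x xj xk - dm_lower ai bi aj bj ak bk x xj xk =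
    ai * (wu xj xk - wl xj xk) + (U - L) * (x - ai) + 0 * (x - ai) ^+ 2
    + 0 * (x - ai) ^+ 3
    + (-1) * pospart ((U - L) * (x - ai) - di * (wu xj xk - L))
    + 0 * pospart ((U - L) * (x - ai) - di * (wu xj xk - L)) ^+ 2
    + (-1) * pospart ((U - L) * (x - ai) - di * (U - wl xj xk))
    + 0 * pospart ((U - L) * (x - ai) - di * (U - wl xj xk)) ^+ 2.
    by rewrite [LHS]mc_gapE /di; ring.
  over.
(* Both kinks lie in the interval because [L <= wl <= wu <= U]. *)
rewrite /= integral_spline//; first last.
- rewrite mulr_ge0 ?(ltW di0) ?subr_ge0 ?(le_trans L2)//=.
  by rewrite mulrC ler_wpM2r ?(ltW di0)// lerB.
- rewrite mulr_ge0 ?(ltW di0) ?subr_ge0 ?(le_trans L1)//=.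
  by rewrite mulrC ler_wpM2r ?(ltW di0)// lerB.
- by rewrite subr_gt0.
- by rewrite subr_gt0.
congr EFin; rewrite /fibre_integral /di; field; rewrite subr_eq0 gt_eqF//.
Qed.

Let D := U - L.
Let di := bi - ai.
Let dj := bj - aj.
Let dk := bk - ak.
Let K := di ^+ 2 / (2 * D).

(** Coefficients of the double integral in powers of [s = xk - ak]. In the integrand over [xj], the
    kinks of the upper and lower envelope carry the linear coefficients [mu0 + mu1 * s] and
    [nu0 + nu1 * s] and the quadratic ones [m2] and [n2]. *)
Let coef (i : nat) : R :=
  let mu0 := - (ai * di) - 2 * K * D in let mu1 := 2 * K * (aj + bk * dj / dk) in
  let nu0 := - (ai * di) - 2 * K * ak * dj in
  let nu1 := - 2 * K * (aj - ak * dj / dk) in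
  let m2 := - K * (1 - 2 * bk / dk) in let n2 := - K * (1 + 2 * ak / dk) in
  nth 0 [:: dj ^+ 2 / 2 * (ai * di * dk + 2 * K * bk * D)
      - K * dj ^+ 3 / 3 * (bk ^+ 2 + ak ^+ 2)
      + dj ^+ 2 / (2 * dk) * (mu0 * dk ^+ 2)
      + m2 * dj ^+ 3 / (3 * dk) * dk ^+ 3;
    2 * K * D * aj * dj - dj ^+ 2 * K * aj * (bk + ak)
      + dj ^+ 2 / (2 * dk) * (mu1 * dk ^+ 2 - 2 * mu0 * dk)
      - m2 * dj ^+ 3 * dk;
    - 2 * K * aj ^+ 2 * dj + dj ^+ 2 / (2 * dk) * (mu0 - 2 * mu1 * dk)
      + m2 * dj ^+ 3 + dj ^+ 2 / (2 * dk) * nu0;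
    dj ^+ 2 / (2 * dk) * mu1 - m2 * dj ^+ 3 / (3 * dk)
      + dj ^+ 2 / (2 * dk) * nu1 + n2 * dj ^+ 3 / (3 * dk)] i.

Lemma integral2_double_mccormick (xk : R) :
  (\int[mu]_xj \int[mu]_xi
     mu [set f | double_mccormick ai bi aj bj ak bk f xi xj xk] =
  (if (ak <= xk <= bk)%R then
     (coef 0 + coef 1 * (xk - ak) + coef 2 * (xk - ak) ^+ 2
      + coef 3 * (xk - ak) ^+ 3)%R%:E else 0))%E.
Proof.
under eq_integral do rewrite integral1_double_mccormick.
case: ifPn => xkb; last exact: integral0.
have DU : D != 0 by rewrite /D subr_eq0 gt_eqF// mulr_lt_bounds.
have ajbj : aj < bj by case/andP: hj.
have dk0 : 0 < dk by rewrite subr_gt0; case/andP: hk.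
have dkN : dk != 0 by rewrite gt_eqF.
have dj0 : 0 < dj by rewrite subr_gt0.
rewrite integral_if_itv.
pose s := xk - ak.
have s0 : 0 <= s by rewrite subr_ge0; case/andP: xkb.
have sk : s <= dk by rewrite lerB//; case/andP: xkb.
pose v := dj * s; pose v' := dj * (dk - s).
have wuE (x : R) : wu x xk = L + aj * s + bk * (x - aj) - pospart (dk * (x - aj) - v).
  by rewrite /mc_upper -/dk -/dj -/s -/v /s; congr (_ - _); ring.
have wlE (x : R) : wl x xk = L + aj * s + ak * (x - aj) + pospart (dk * (x - aj) - v').
  rewrite /mc_lower -/dk -/dj; have -> : dj * (bk - xk) = v' by rewrite /v' /s /dk; ring.
  by congr (_ + _); rewrite /s; ring.
(* Removes products of the variable with a positive part, which the spline shape does not contain,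
   by writing [dk * t] as [(dk * t - w) + w]. *)
have posE (t w : R) : t * pospart (dk * t - w) =
    (pospart (dk * t - w) ^+ 2 + w * pospart (dk * t - w)) / dk.
  by rewrite -mulr_pospart; field.
under eq_integral => x _.
  have -> : fibre_integral x xk =
    - K * (- 2 * aj * s * D + 2 * aj ^+ 2 * s ^+ 2)
    + (ai * di * dk + 2 * K * (D - aj * s) * bk - 2 * K * ak * aj * s) * (x - aj)
    + - K * (bk ^+ 2 + ak ^+ 2) * (x - aj) ^+ 2
    + 0 * (x - aj) ^+ 3
    + (- (ai * di) - 2 * K * (D - aj * s - bk * v / dk)) * pospart (dk * (x - aj) - v)
    + - K * (1 - 2 * bk / dk) * pospart (dk * (x - aj) - v) ^+ 2
    + (- (ai * di) - 2 * K * (aj * s + ak * v' / dk)) * pospart (dk * (x - aj) - v')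
    + - K * (1 + 2 * ak / dk) * pospart (dk * (x - aj) - v') ^+ 2.
    rewrite /fibre_integral -/D -/di -/K wuE wlE.
    move: (posE (x - aj) v) (posE (x - aj) v').
    set P := pospart (_ - v); set Q := pospart (_ - v').
    set t := x - aj; move=> tP tQ.
    (* The envelopes are squared separately, so no product [P * Q] arises; [t * P] and [t * Q] are
       kept whole for rewriting. *)
    transitivity (ai * di * (dk * t - P - Q) + K * (D ^+ 2
      - ((D - aj * s - bk * t) ^+ 2 + 2 * (D - aj * s) * P - 2 * bk * (t * P) + P ^+ 2)
      - ((ak * t + aj * s) ^+ 2 + 2 * (aj * s) * Q + 2 * ak * (t * Q) + Q ^+ 2))).
      by rewrite /dk /D; ring.
    by rewrite tP tQ; field.
  over.
rewrite /= integral_spline//; last 2 first.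
- have dj1 := ltW dj0.
  by rewrite -/dj [X in _ <= _ <= X]mulrC /v mulr_ge0//= ler_wpM2l.
- have dj1 := ltW dj0.
  by rewrite -/dj [X in _ <= _ <= X]mulrC /v' ler_wpM2l ?gerBl// mulr_ge0// subr_ge0.
rewrite -/dj -/s /coef /=; congr EFin; rewrite /v' /v.
(* The values of the two kink arguments at the right end [bj]. *)
have -> : dk * dj - dj * s = dj * (dk - s) by ring.
have -> : dk * dj - dj * (dk - s) = dj * s by ring.
by field.
Qed.

Lemma integral3_double_mccormick :
  (\int[mu]_xk \int[mu]_xj \int[mu]_xi
     mu [set f | double_mccormick ai bi aj bj ak bk f xi xj xk] =
  (double_mccormick_vol ai bi aj bj ak bk)%:E)%E.
Proof.
under eq_integral do rewrite integral2_double_mccormick.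
have DU : D != 0 by rewrite /D subr_eq0 gt_eqF// mulr_lt_bounds.
have akbk : ak < bk by case/andP: hk.
have dk0 : 0 < dk by rewrite subr_gt0.
have dkN : dk != 0 by rewrite gt_eqF.
rewrite integral_if_itv.
under eq_integral => x _.
  (* The last integrand is a cubic polynomial; dummy kinks with coefficient 0, slope 1 and offset 0
     complete the spline shape. *)
  have -> : coef 0 + coef 1 * (x - ak) + coef 2 * (x - ak) ^+ 2 + coef 3 * (x - ak) ^+ 3
    = coef 0 + coef 1 * (x - ak) + coef 2 * (x - ak) ^+ 2 + coef 3 * (x - ak) ^+ 3
      + 0 * pospart (1 * (x - ak) - 0) + 0 * pospart (1 * (x - ak) - 0) ^+ 2
      + 0 * pospart (1 * (x - ak) - 0) + 0 * pospart (1 * (x - ak) - 0) ^+ 2.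
    by ring.
  over.
rewrite /= integral_spline ?ltr01 ?lexx ?mul1r ?(ltW dk0)// -/dk /coef /=.
congr EFin; rewrite /double_mccormick_vol /K /di /dj.
move: DU dkN; rewrite /D /dk => DU dkN.
by field; apply/andP.
Qed.

End double_mccormick_integral.

(** * Volumes of the three relaxations *)

Section Vol_double_mccormick.
Variable R : realType.
Local Notation T := (measurableTypeR R).
Local Notation T4 := (T * T * T * T)%type.

Lemma measurable_space4_f : measurable_fun setT (fun p : T4 => p.1.1.1).
Proof.
exact: measurableT_comp measurable_fst (measurableT_comp measurable_fst measurable_fst).
Qed.

Lemma measurable_space4_x1 : measurable_fun setT (fun p : T4 => p.1.1.2).
Proof.
exact: measurableT_comp measurable_snd (measurableT_comp measurable_fst measurable_fst).
Qed.

Lemma measurable_space4_x2 : measurable_fun setT (fun p : T4 => p.1.2).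
Proof. exact: measurableT_comp measurable_snd measurable_fst. Qed.

Lemma Vol_P1 (a1 b1 a2 b2 a3 b3 : R) :
  0 <= a1 < b1 -> 0 <= a2 < b2 -> 0 <= a3 < b3 ->
  Vol (P1 a1 b1 a2 b2 a3 b3) = (double_mccormick_vol a1 b1 a2 b2 a3 b3)%:E.
Proof.
move=> h1 h2 h3; rewrite -integral3_double_mccormick//.
apply: Vol_integral123.
rewrite (_ : P1 _ _ _ _ _ _ = [set p | double_mccormick a1 b1 a2 b2 a3 b3
  p.1.1.1 p.1.1.2 p.1.2 p.2]); last by apply/seteqP; split => -[[[f x1] x2] x3].
exact: (@measurable_double_mccormick _ T4 R _ _ _ _ _ _
  (fun p => p.1.1.1) (fun p => p.1.1.2)
  (fun p => p.1.2) (fun p => p.2)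
  h1 h2 h3 measurable_space4_f measurable_space4_x1 measurable_space4_x2 measurable_snd).
Qed.

Lemma Vol_P2 (a1 b1 a2 b2 a3 b3 : R) :
  0 <= a1 < b1 -> 0 <= a2 < b2 -> 0 <= a3 < b3 ->
  Vol (P2 a1 b1 a2 b2 a3 b3) = (double_mccormick_vol a2 b2 a1 b1 a3 b3)%:E.
Proof.
move=> h1 h2 h3; rewrite -integral3_double_mccormick//.
apply: Vol_integral213.
rewrite (_ : P2 _ _ _ _ _ _ = [set p | double_mccormick a2 b2 a1 b1 a3 b3
  p.1.1.1 p.1.2 p.1.1.2 p.2]); last by apply/seteqP; split => -[[[f x1] x2] x3].
exact: (@measurable_double_mccormick _ T4 R _ _ _ _ _ _
  (fun p => p.1.1.1) (fun p => p.1.2)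
  (fun p => p.1.1.2) (fun p => p.2)
  h2 h1 h3 measurable_space4_f measurable_space4_x2 measurable_space4_x1 measurable_snd).
Qed.

Lemma Vol_P3 (a1 b1 a2 b2 a3 b3 : R) :
  0 <= a1 < b1 -> 0 <= a2 < b2 -> 0 <= a3 < b3 ->
  Vol (P3 a1 b1 a2 b2 a3 b3) = (double_mccormick_vol a3 b3 a1 b1 a2 b2)%:E.
Proof.
move=> h1 h2 h3; rewrite -integral3_double_mccormick//.
apply: Vol_integral312.
rewrite (_ : P3 _ _ _ _ _ _ = [set p | double_mccormick a3 b3 a1 b1 a2 b2
  p.1.1.1 p.2 p.1.1.2 p.1.2]); last by apply/seteqP; split => -[[[f x1] x2] x3].
exact: (@measurable_double_mccormick _ T4 R _ _ _ _ _ _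
  (fun p => p.1.1.1) (fun p => p.2)
  (fun p => p.1.1.2) (fun p => p.1.2)
  h3 h1 h2 measurable_space4_f measurable_snd measurable_space4_x1 measurable_space4_x2).
Qed.

End Vol_double_mccormick.

(** * The chain of volume inequalities *)

Theorem corollary4p1 (R : realType) (a1 b1 a2 b2 a3 b3 : R)
  (h1 : 0 <= a1 < b1) (h2 : 0 <= a2 < b2) (h3 : 0 <= a3 < b3)
  (h12 : a1 * b2 * b3 + b1 * a2 * a3 <= b1 * a2 * b3 + a1 * b2 * a3)
  (h23 : b1 * a2 * b3 + a1 * b2 * a3 <= b1 * b2 * a3 + a1 * a2 * b3) :
  [/\ (Vol (trilinear_hull a1 b1 a2 b2 a3 b3) <= Vol (P3 a1 b1 a2 b2 a3 b3))%E,
      (Vol (P3 a1 b1 a2 b2 a3 b3) <= Vol (P2 a1 b1 a2 b2 a3 b3))%E &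
      (Vol (P2 a1 b1 a2 b2 a3 b3) <= Vol (P1 a1 b1 a2 b2 a3 b3))%E].
Proof.
have d1 : 0 < b1 - a1 by case/andP: h1; rewrite subr_gt0.
have d3 : 0 < b3 - a3 by case/andP: h3; rewrite subr_gt0.
split.
- by apply/le_Vol/trilinear_hull_P3 => //; case/andP: h3.
- rewrite Vol_P2// Vol_P3// lee_fin.
  (* Symmetry in the inner pair moves the common variable x_1 to the last place, so that x_2 and x_3
     are the exchanged ones. *)
  rewrite [leLHS]double_mccormick_vol_sym [leRHS]double_mccormick_vol_sym.
  rewrite le_double_mccormick_vol//.
  by rewrite -subr_ge0 -(pmulr_rge0 _ d1); lra.
- rewrite Vol_P1// Vol_P2// lee_fin le_double_mccormick_vol//.
  by rewrite -subr_ge0 -(pmulr_rge0 _ d3); lra.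
Qed.
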